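(* Let $n\ge 1$, let $a_1,\dots,a_n\in\mathbb D$, let $\epsilon\in\mathbb T$, and let $B(z)=\epsilon\prod_{k=1}^n\frac{z-a_k}{1-\overline{a_k}z}$. Let $\mathbb I=[-\pi,\pi)$, let $T_0\subset\mathbb I$ be the set of critical parameters of $B$, and let $\tau_0,\dots,\tau_{n-1}$ be the functions defined in the context. Then for every $t\in\mathbb I$ with $t\notin T_0$ the equation $B(z)=re^{it}$ has, for each $k\in\{0,\dots,n-1\}$, a single, unique (continuous in $r$) solution $\varphi_k(r,t)$ for which $$B(\varphi_k(r,t))=re^{it},\qquad \varphi_k(1,t)=e^{i\tau_k(t)}\qquad(0\le r\le 1,\ k=0,\dots,n-1).$$ Furthermore, these solution curves (for $t\in\mathbb I\setminus T_0$ and $k=0,\dots,n-1$) are disjoint for $r>0$, and their union is the closed disk $\overline{\mathbb D}$.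
   Context: $\mathbb D=\{z\in\mathbb C:|z|<1\}$, $\overline{\mathbb D}$ is its closure, $\mathbb T=\{z\in\mathbb C:|z|=1\}$. For $t\in\mathbb I=[-\pi,\pi)$ put $S_t=\{re^{it}:0\le r\le 1\}$. The set of critical points of $B$ is $A'=\{b\in\mathbb C:B'(b)=0\}$, and the critical values are the numbers $B(b)$, $b\in A'$. A number $t\in\mathbb I$ is a critical parameter if the segment $S_t$ contains a critical value; $T_0$ is the set of critical parameters. It is known that there is a strictly increasing function $\beta:\mathbb R\to\mathbb R$ with $\beta(t+2\pi)=\beta(t)+2\pi$ and $B(e^{it})=e^{in\beta(t)}$ for all $t\in\mathbb R$ (it can be given explicitly in terms of the parameters of $B$, and is continuous). Define $\tau_k(t)=\beta^{-1}\left(\frac{t}{n}+\frac{2k\pi}{n}\right)$ for $t\in\mathbb R$, $k=0,\dots,n-1$, so that $B(e^{i\tau_k(t)})=e^{it}$.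
   Formalization: The union claim fails when T_0 is nonempty (e.g. B=z^2, where T_0=I); proved instead: the union is the set of z in the closed disk with B(z) in some S_t, t in I\T_0, and its closure is the closed disk whenever I\T_0 is nonempty. *)

(* Defs.v *)
(* The complex plane is [R[i]]; the alias [R[i]^o] is the same type, and is the one that carries
   the topology and the normed structure used by limits and derivatives. *)
From HB Require Import structures.
From mathcomp Require Export all_boot all_order all_algebra.
From mathcomp Require Export all_classical all_reals all_analysis.
From mathcomp Require Export complex.
Set Implicit Arguments.
Unset Strict Implicit.
Unset Printing Implicit Defensive.
Export Order.TTheory GRing.Theory Num.Theory.
Export numFieldNormedType.Exports.
Local Open Scope classical_set_scope.
Local Open Scope ring_scope.
Local Open Scope complex_scope.

Definition cis {R : realType} (t : R) : R[i] := cos t +i* sin t.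

Definition closed_disk {R : realType} : set R[i] := [set z | `|z| <= 1].

Definition param_interval {R : realType} : set R := `[- pi, pi[%classic.

Definition segment {R : realType} (t : R) : set R[i] :=
  [set r%:C * cis t | r in `[0, 1]].

Section Blaschke.
Variables (R : realType) (n : nat) (a : 'I_n -> R[i]) (eps : R[i]).

Definition blaschke (z : R[i]) : R[i] :=
  eps * \prod_(k < n) ((z - a k) / (1 - (a k)^* * z)).

(* Division by zero yields a value, so [blaschke] is total; every use of its
   value or derivative at an unrestricted point is guarded by this predicate,
   the complement of the set of poles. *)
Definition blaschke_dom (z : R[i]) : Prop :=
  forall k : 'I_n, 1 - (a k)^* * z != 0.

Definition critical_point (b : R[i]) : Prop :=
  blaschke_dom b /\ derive1 (blaschke : R[i]^o -> R[i]^o) b = 0.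

Definition critical_value (w : R[i]) : Prop :=
  exists2 b : R[i], critical_point b & w = blaschke b.

Definition critical_params : set R :=
  [set t | param_interval t /\ exists2 w, segment t w & critical_value w].

Definition regular_params : set R := param_interval `\` critical_params.

(* The properties that determine [beta] up to an additive constant in
   (2 pi / n) Z. *)
Definition blaschke_argument (beta : R -> R) : Prop :=
  [/\ {homo beta : s t / s < t},
      forall t, beta (t + 2 * pi) = beta t + 2 * pi,
      continuous beta &
      forall t, blaschke (cis t) = cis (n%:R * beta t)].

(* Such a [beta] is a bijection of R, so the partial inverse is its inverse. *)
Definition tau (beta : R -> R) (k : 'I_n) (t : R) : R :=
  pinv [set: R] beta (t / n%:R + 2 * k%:R * pi / n%:R).

Definition solution_curve (beta : R -> R) (k : 'I_n) (t : R)
    (psi : R -> R[i]^o) : Prop :=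
  [/\ {within `[0, 1], continuous psi},
      forall r, 0 <= r <= 1 ->
        blaschke_dom (psi r) /\ blaschke (psi r) = r%:C * cis t &
      psi 1 = cis (tau beta k t)].

End Blaschke.

(* Main.v *)
(* The solutions of [B z = w] are the roots of [N - w D], where [B = N / D]; for [|w| <= 1] this
   polynomial has degree exactly [n], its leading coefficient is bounded away from 0 uniformly in
   [w], and all its roots lie in the closed disk.  Evaluating the factored polynomial at a solution
   [z] of [B z = w0] gives a root [z'] with [|z - z'|^n <= C |w0 - w|]: the roots move uniformly
   continuously, in both directions.  Over a regular ray the roots are simple, hence, by compactness
   of the ray, uniformly separated; so every root is continued in steps of a fixed length to a unique
   continuous curve, and by counting the [n] curves exhaust every fibre.  Since [N' D - N D'] has
   finitely many zeros, regular parameters are dense as soon as one exists, and the same root estimate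
   then gives the density of the curves in the disk. *)
Require Import Defs.
From mathcomp Require Import separable lra ring.
Set Implicit Arguments.
Unset Strict Implicit.
Unset Printing Implicit Defensive.
Import Normc.
Local Open Scope classical_set_scope.
Local Open Scope ring_scope.
Local Open Scope complex_scope.

(** * The real-valued modulus, and the topology it induces *)

Section ComplexNorm.
Variable R : realType.
Implicit Types z w y : R[i].

Lemma normCE z : `|z| = (normc z)%:C.
Proof. by []. Qed.

Lemma normc_ge0 z : 0 <= normc z.
Proof. by case: z => x y /=; exact: sqrtr_ge0. Qed.

Lemma normc_eq0 z : (normc z == 0) = (z == 0).
Proof.
by apply/eqP/eqP => [/eq0_normc //|->]; rewrite normc0.
Qed.

Lemma normc_distC z w : normc (z - w) = normc (w - z).
Proof. by rewrite -opprB normcN. Qed.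

Lemma normc_triangle z w y : normc (z - y) <= normc (z - w) + normc (w - y).
Proof.
by rewrite (_ : z - y = (z - w) + (w - y)) ?le_normcD // addrA subrK.
Qed.

Lemma normc_dist z w : `|normc z - normc w| <= normc (z - w).
Proof.
rewrite ler_norml; apply/andP; split.
- have := le_normcD (w - z) z; rewrite subrK normc_distC; lra.
- have := le_normcD (z - w) w; rewrite subrK; lra.
Qed.

Lemma normc_real (x : R) : normc x%:C = `|x|.
Proof. by rewrite /= expr0n /= addr0 sqrtr_sqr. Qed.

Lemma normc_prod I (s : seq I) (F : I -> R[i]) :
  normc (\prod_(i <- s) F i) = \prod_(i <- s) normc (F i).
Proof.
by elim: s => [|i s IH]; rewrite ?big_nil ?normc1 // !big_cons normcM IH.
Qed.

Lemma normc_sqr z : normc z ^+ 2 = complex.Re z ^+ 2 + complex.Im z ^+ 2.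
Proof. by case: z => x y /=; rewrite sqr_sqrtr // addr_ge0 ?sqr_ge0. Qed.

Lemma normc_le_sqr (w z : R[i]) : (normc z <= normc w) = (normc z ^+ 2 <= normc w ^+ 2).
Proof. by rewrite ler_sqr // nnegrE normc_ge0. Qed.

(** For [normc c < 1] the sign of the right side depends only on the side of the unit circle on
    which [z] lies. This compares numerator and denominator of one Blaschke factor. *)
Lemma blaschke_factor_identity (c z : R[i]) :
  normc (1 - c^* * z) ^+ 2 - normc (z - c) ^+ 2 =
  (1 - normc z ^+ 2) * (1 - normc c ^+ 2).
Proof.
case: c z => c1 c2 [z1 z2]; rewrite !normc_sqr /=; ring.
Qed.

Lemma normc_cis (t : R) : normc (cis t) = 1.
Proof. by rewrite /= cos2Dsin2 sqrtr1. Qed.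

Lemma nbhs_normcP (z : R[i]^o) (A : set R[i]^o) :
  nbhs z A <-> exists2 e : R, 0 < e & forall w, normc (w - z) < e -> A w.
Proof.
split.
  move=> /nbhs_normP[e /= e0 eA]; case: e e0 eA => e f e0 eA.
  (* Radii are complex numbers here, and a positive one has zero imaginary part. *)
  have f0 : f = 0 by move: e0; rewrite ltcE /= => /andP[/eqP].
  subst f; exists e; first by move: e0; rewrite ltcR.
  move=> w we; apply: eA; suff: (normc (z - w))%:C < e%:C by [].
  by rewrite ltcR normc_distC.
move=> [e e0 eA]; apply: (@nbhs_normP _ _ z A).2.
exists e%:C; first by rewrite /= ltcR.
move=> w we; apply: eA; have: (normc (z - w))%:C < e%:C by [].
by rewrite ltcR normc_distC.
Qed.

End ComplexNorm.

(** * Products of linear polynomials and of nonnegative reals *)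

Lemma prod_linear_coef (K : comNzRingType) n (F : 'I_n -> {poly K}) :
  (forall k, (size (F k) <= 2)%N) ->
  (size (\prod_(k < n) F k)%R <= n.+1)%N /\
  (\prod_(k < n) F k)`_n = \prod_(k < n) (F k)`_1.
Proof.
elim: n F => [|n IH] F sF; first by rewrite !big_ord0 size_poly1 coef1.
rewrite !big_ord_recr /=.
have [//|s c] := IH (fun k => F (widen_ord (leqnSn n) k)).
have sFn := sF ord_max.
split.
  apply: leq_trans (size_polyMleq _ _) _.
  rewrite -subn1 leq_subLR add1n -[n.+3]addn2; exact: leq_add s sFn.
(* Only the coefficient [n] of the first factors times the coefficient 1 of the last one survives:
   smaller indices require degree at least 2 in the last factor, and the top index exceeds the
   degree of the others. *)
rewrite coefM big_ord_recr big_ord_recr /= subnn big1 ?add0r; last first.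
  move=> i _; rewrite [X in _ * X]nth_default ?mulr0 //.
  by apply: leq_trans sFn _; rewrite /= subSn ?ltnS ?subn_gt0 // ltnW.
by rewrite [X in _ + X * _]nth_default // mul0r addr0 subSnn c.
Qed.

(** The minimum of the list works, by comparison factor by factor. *)
Lemma exists_le_prod (R : realFieldType) (s : seq R) : (0 < size s)%N ->
  (forall x, x \in s -> 0 <= x) ->
  exists2 x, x \in s & x ^+ size s <= \prod_(y <- s) y.
Proof.
move=> s0 sge0.
have [x xs xmin] : exists2 x, x \in s & forall y, y \in s -> x <= y.
  elim: s s0 {sge0} => // x [|z s] IH _.
    by exists x => [|y]; rewrite inE // => /eqP ->.
  have [//|y ys ymin] := IH _.
  have [xy|yx] := leP x y.
    exists x; rewrite ?mem_head // => t; rewrite in_cons => /predU1P[-> //|/ymin].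
    exact: le_trans.
  exists y; first by rewrite in_cons ys orbT.
  by move=> t; rewrite in_cons => /predU1P[->|/ymin //]; exact: ltW.
exists x => //; have x0 := sge0 _ xs.
elim: (s) xmin => [|y r IH] xr; first by rewrite big_nil.
rewrite big_cons exprS ler_pM ?exprn_ge0 ?xr ?mem_head // IH // => t tr.
by rewrite xr // inE tr orbT.
Qed.


(** * Derivatives of polynomials and quotients *)

Section NumFieldDerivatives.
Variable K : numFieldType.

Lemma is_derive_horner (p : {poly K}) (z : K^o) :
  is_derive z (1 : K^o) (fun x : K^o => p.[x] : K^o) p^`().[z].
Proof.
elim/poly_ind: p => [|p c IH].
  rewrite deriv0 horner0 (_ : (fun _ => _) = cst 0); last first.
    by apply/funext => x; rewrite horner0.
  exact: is_derive_cst.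
rewrite (_ : (fun _ => _) =
    (fun x : K^o => p.[x] : K^o) * id + cst c); last first.
  by apply/funext => x; rewrite !hornerE.
rewrite derivD derivM derivX derivC addr0 mulr1 !hornerE.
apply: is_derive_eq.
by rewrite addr0 addrC [_ *: 1]mulr1 [z *: _]mulrC.
Qed.

Lemma derive1_quotient (f g : K^o -> K^o) (x df dg : K^o) :
  is_derive x 1 f df -> is_derive x 1 g dg -> g x != 0 ->
  derive1 (fun y => f y / g y : K^o) x = (df * g x - f x * dg) / g x ^+ 2.
Proof.
move=> dF dG g0.
have dV : derivable (fun y => (g y)^-1 : K^o) x 1.
  by apply: derivableV g0 _; exact: ex_derive.
rewrite derive1E (@deriveM _ _ f (fun y => (g y)^-1)) //.
rewrite deriveV // !derive_val.
suff: f x * (- g x ^- 2 * dg) + (g x)^-1 * df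
    = (df * g x - f x * dg) / g x ^+ 2 by [].
by field.
Qed.

End NumFieldDerivatives.

(** * Numerator, denominator and fibre polynomials of the Blaschke product *)

Section BlaschkePolynomials.
Variables (R : realType) (n : nat) (a : 'I_n -> R[i]) (eps : R[i]).
Implicit Types w z : R[i].

Definition bnum : {poly R[i]} := eps *: \prod_(k < n) ('X - (a k)%:P).
Definition bden : {poly R[i]} := \prod_(k < n) (1 - (a k)^* *: 'X).
Definition fiber_poly w := bnum - w *: bden.
(** The numerator of B' over the squared denominator; away from the poles its zeros are the critical
    points. *)
Definition bwronskian := bnum^`() * bden - bnum * bden^`().

Lemma horner_bnum z : bnum.[z] = eps * \prod_(k < n) (z - a k).
Proof.
by rewrite /bnum hornerZ horner_prod; under eq_bigr do rewrite !hornerE.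
Qed.

Lemma horner_bden z : bden.[z] = \prod_(k < n) (1 - (a k)^* * z).
Proof. by rewrite /bden horner_prod; under eq_bigr do rewrite !hornerE. Qed.

Lemma blaschkeE z : blaschke a eps z = bnum.[z] / bden.[z].
Proof.
by rewrite /blaschke prodf_div mulrA horner_bnum horner_bden.
Qed.

Lemma blaschke_domE z : blaschke_dom a z <-> bden.[z] != 0.
Proof.
rewrite horner_bden; split => [h|/prodf_neq0 h k]; last exact: h.
by apply/prodf_neq0 => k _; exact: h.
Qed.

Lemma root_fiber_poly w z :
  root (fiber_poly w) z = (bnum.[z] == w * bden.[z]).
Proof. by rewrite /root /fiber_poly !hornerE subr_eq0. Qed.

Lemma derive1_blaschke z : blaschke_dom a z ->
  derive1 (blaschke a eps : R[i]^o -> R[i]^o) z =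
  bwronskian.[z] / bden.[z] ^+ 2.
Proof.
move=> /blaschke_domE d0.
have -> : (blaschke a eps : R[i]^o -> R[i]^o) =
    (fun x : R[i]^o => bnum.[x] / bden.[x] : R[i]^o).
  by apply/funext => x; exact: blaschkeE.
rewrite (@derive1_quotient _ _ _ _ _ _
  (is_derive_horner bnum z) (is_derive_horner bden z) d0).
by rewrite /bwronskian hornerD hornerN !hornerM.
Qed.

End BlaschkePolynomials.

(** * Location, number and displacement of the roots in a fibre *)

Section BlaschkeFibers.
Variables (R : realType) (n : nat) (a : 'I_n -> R[i]) (eps : R[i]).
Hypothesis n_gt0 : (0 < n)%N.
Hypothesis a_lt1 : forall k, normc (a k) < 1.
Hypothesis eps1 : normc eps = 1.
Implicit Types w z : R[i].

Lemma normc_conj z : normc (z^*) = normc z.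
Proof. by case: z => x y /=; rewrite sqrrN. Qed.

Lemma factor_neq0 k z : normc z <= 1 -> 1 - (a k)^* * z != 0.
Proof.
move=> z1; rewrite subr_eq0; apply/negP => /eqP /(congr1 (@normc R)).
rewrite normc1 normcM normc_conj.
have := a_lt1 k; have := normc_ge0 z; have := normc_ge0 (a k); nra.
Qed.

Lemma closed_disk_dom z : normc z <= 1 -> blaschke_dom a z.
Proof. by move=> z1 k; exact: factor_neq0. Qed.

Lemma blaschke_le1 z : normc z <= 1 -> normc (blaschke a eps z) <= 1.
Proof.
move=> z1; have d0 : (bden a).[z] != 0 by apply/blaschke_domE/closed_disk_dom.
rewrite blaschkeE normcM normcV ler_pdivrMr ?mul1r; last first.
  by rewrite lt_neqAle eq_sym normc_eq0 d0 normc_ge0.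
rewrite horner_bnum horner_bden normcM eps1 mul1r !normc_prod.
apply: ler_prod => k _; rewrite normc_ge0 normc_le_sqr -subr_ge0.
rewrite blaschke_factor_identity mulr_ge0 // subr_ge0 expr_le1 ?normc_ge0 //.
by rewrite ltW ?a_lt1.
Qed.

(** Outside the closed disk every factor of N is strictly larger in modulus than the matching factor
    of D, so |N| > |D| >= |w D|. *)
Lemma fiber_in_disk w z : normc w <= 1 ->
  root (fiber_poly a eps w) z -> normc z <= 1.
Proof.
move=> w1; rewrite root_fiber_poly horner_bnum horner_bden => /eqP h.
rewrite leNgt; apply/negP => z1.
have lt k : normc (1 - (a k)^* * z) < normc (z - a k).
  rewrite ltNge normc_le_sqr -ltNge -subr_lt0 blaschke_factor_identity.
  rewrite nmulr_rlt0 ?subr_lt0 ?expr_gt1 ?normc_ge0 //.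
  by rewrite subr_gt0 expr_lt1 ?normc_ge0.
have : normc (\prod_(k < n) (1 - (a k)^* * z)) <
    normc (\prod_(k < n) (z - a k)).
  rewrite !normc_prod; apply: ltr_prod => [|k _]; last by rewrite normc_ge0 lt.
  by apply/hasP; exists (Ordinal n_gt0) => //; rewrite mem_index_enum.
move/(congr1 (@normc R)): h; rewrite !normcM eps1 mul1r => ->.
have := normc_ge0 (\prod_(k < n) (1 - (a k)^* * z)); nra.
Qed.

(* Lower bound for [|eps - w * \prod_k - (a k)^*|], the modulus of the leading coefficient. *)
Definition lead_gap := 1 - \prod_(k < n) normc (a k).

Lemma lead_gap_gt0 : 0 < lead_gap.
Proof.
have : \prod_(k < n) normc (a k) < \prod_(k < n) (1 : R).
  apply: ltr_prod => [|k _]; last by rewrite normc_ge0 a_lt1.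
  by apply/hasP; exists (Ordinal n_gt0) => //; rewrite mem_index_enum.
by rewrite [X in _ < X]big1 // subr_gt0.
Qed.

(** The coefficient of degree n is [eps - w * \prod_k - (a k)^*], so the reverse triangle inequality
    bounds it below. That it is nonzero then fixes the size. *)
Lemma fiber_poly_lead w : normc w <= 1 ->
  size (fiber_poly a eps w) = n.+1 /\
  lead_gap <= normc (lead_coef (fiber_poly a eps w)).
Proof.
move=> w1.
have [|sN cN] := @prod_linear_coef _ n (fun k => 'X - (a k)%:P).
  by move=> k; rewrite size_XsubC.
have [|sD cD] := @prod_linear_coef _ n (fun k => 1 - (a k)^* *: 'X).
  move=> k; apply: leq_trans (size_polyD _ _) _.
  rewrite size_poly1 size_polyN geq_max /=.
  by apply: leq_trans (size_scale_leq _ _) _; rewrite size_polyX.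
have sP : (size (fiber_poly a eps w) <= n.+1)%N.
  apply: leq_trans (size_polyD _ _) _; rewrite size_polyN geq_max.
  by rewrite !(leq_trans (size_scale_leq _ _)).
have gap : lead_gap <= normc ((fiber_poly a eps w)`_n).
  rewrite coefB !coefZ cN cD big1 ?mulr1; last first.
    by move=> k _; rewrite coefB coefX coefC subr0.
  under eq_bigr do rewrite coefB coefZ coefX coef1 sub0r mulr1.
  have := le_normcD (eps - w * (\prod_(k < n) - (a k)^*))
    (w * (\prod_(k < n) - (a k)^*)).
  rewrite subrK eps1 normcM normc_prod /lead_gap.
  under eq_bigr do rewrite normcN normc_conj.
  have : 0 <= \prod_(k < n) normc (a k).
    by apply: prodr_ge0 => k _; exact: normc_ge0.
  have := normc_ge0 w; nra.
have sE : size (fiber_poly a eps w) = n.+1.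
  apply/eqP; rewrite eqn_leq sP ltnNge; apply/negP => sn.
  by move: gap; rewrite nth_default // normc0 leNgt lead_gap_gt0.
by split=> //; rewrite lead_coefE sE.
Qed.

Lemma fiber_poly_split w : normc w <= 1 ->
  exists2 rs : seq R[i], size rs = n & fiber_poly a eps w =
    lead_coef (fiber_poly a eps w) *: \prod_(x <- rs) ('X - x%:P).
Proof.
move=> w1; have [sz lc] := fiber_poly_lead w1.
have [rs prs] := closed_field_poly_normal (fiber_poly a eps w).
exists rs => //; move: sz; rewrite prs size_scale.
  by rewrite size_prod_XsubC => -[].
apply/eqP => l0; move: lc; rewrite l0 normc0 leNgt.
by rewrite lead_gap_gt0.
Qed.

(* The product of the distances from [z] to the roots is at least the [n]th power of the least one. *)
Lemma blaschke_fiber_dist w z : normc w <= 1 -> normc z <= 1 ->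
  exists2 z', root (fiber_poly a eps w) z' &
    normc (z - z') ^+ n <= 2 ^+ n / lead_gap * normc (blaschke a eps z - w).
Proof.
move=> w1 z1.
have [rs szrs prs] := fiber_poly_split w1.
have [_ lc] := fiber_poly_lead w1.
have [||x /mapP[z' z'rs ->]] := @exists_le_prod _ [seq normc (z - x) | x <- rs].
- by rewrite size_map szrs.
- by move=> x /mapP[y _ ->]; exact: normc_ge0.
rewrite size_map szrs big_map => le; exists z'.
  by rewrite prs rootZ ?root_prod_XsubC // lead_coef_eq0 -size_poly_eq0
    (fiber_poly_lead w1).1.
apply: le_trans le _.
have d0 : (bden a).[z] != 0 by apply/blaschke_domE/closed_disk_dom.
(* The value at [z] is D(z) (B(z) - w), and each of the n factors of D has modulus at most 2 on the
   closed disk. *)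
have : normc (fiber_poly a eps w).[z] <= 2 ^+ n * normc (blaschke a eps z - w).
  have -> : (fiber_poly a eps w).[z] = (bden a).[z] * (blaschke a eps z - w).
    rewrite blaschkeE mulrBr mulrCA divff // mulr1 [_ * w]mulrC.
    by rewrite /fiber_poly !hornerE.
  rewrite normcM ler_wpM2r ?normc_ge0 // horner_bden normc_prod.
  rewrite -[n in leRHS]card_ord -prodr_const.
  apply: ler_prod => k _; rewrite normc_ge0 /=.
  apply: le_trans (le_normcD _ _) _; rewrite normc1 normcN normcM.
  rewrite normc_conj.
  have := a_lt1 k; have := normc_ge0 z; have := normc_ge0 (a k); nra.
rewrite {1}prs hornerZ normcM horner_prod normc_prod.
under eq_bigr do rewrite !hornerE.
have p0 : 0 <= \prod_(x <- rs) normc (z - x).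
  by apply: prodr_ge0 => k _; exact: normc_ge0.
rewrite mulrAC ler_pdivlMr ?lead_gap_gt0 // => /(le_trans _); apply.
by rewrite mulrC ler_wpM2r.
Qed.

(** At a multiple root both N = w D and N' = w D', whence N' D - N D' = 0. *)
Lemma fiber_simple_roots w : normc w <= 1 ->
  (forall z, root (fiber_poly a eps w) z -> (bwronskian a eps).[z] != 0) ->
  exists rs : seq R[i],
    [/\ size rs = n, uniq rs & forall z, (z \in rs) = root (fiber_poly a eps w) z].
Proof.
move=> w1 reg; have [rs szrs prs] := fiber_poly_split w1.
have lc0 : lead_coef (fiber_poly a eps w) != 0.
  by rewrite lead_coef_eq0 -size_poly_eq0 (fiber_poly_lead w1).1.
have mem z : (z \in rs) = root (fiber_poly a eps w) z.
  by rewrite prs rootZ ?root_prod_XsubC.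
exists rs; split=> //; rewrite -separable_prod_XsubC unlock.
apply: Pdiv.ClosedField.root_coprimep => z; rewrite root_prod_XsubC mem => rz.
move: (reg z rz); apply: contraNneq => q0.
have p0 : (fiber_poly a eps w)^`().[z] = 0.
  by rewrite prs derivZ hornerZ q0 mulr0.
move: rz p0; rewrite root_fiber_poly => /eqP Nz.
rewrite derivB (derivZ w) hornerD hornerN (hornerZ w) => /eqP; rewrite subr_eq0 => /eqP N'z.
by rewrite /bwronskian hornerD hornerN !hornerM Nz N'z mulrAC subrr.
Qed.

End BlaschkeFibers.

(** * Continuous lifting through uniformly separated fibres *)

Lemma continuous_normc (R : realType) : continuous (@normc R : R[i]^o -> R).
Proof.
move=> z A /nbhs_ballP[e e0 eA]; apply/nbhs_normcP; exists e => // w zw.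
by apply: eA; apply: le_lt_trans (normc_dist _ _) _; rewrite normc_distC.
Qed.

Lemma within_continuous_normc_sub (R : realType) (A : set R) (f g : R -> R[i]^o) :
  {within A, continuous f} -> {within A, continuous g} ->
  {within A, continuous (fun x => normc (f x - g x))}.
Proof.
move=> cf cg x.
apply: (@cvg_comp _ _ _ (fun x => f x - g x : R[i]^o) (@normc R)).
  apply: (@cvgB _ _ _ (nbhs x) _ f g). exact: cf.
  exact: cg.
exact: continuous_normc.
Qed.

Section Lifting.
Variables (R : realType) (Z : R -> set R[i]) (delta : R).
Hypothesis delta_gt0 : 0 < delta.
Hypothesis Z_sep : forall r x y, 0 <= r <= 1 -> Z r x -> Z r y ->
  normc (x - y) < delta -> x = y.
Hypothesis Z_near : forall e, 0 < e -> exists2 eta, 0 < eta &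
  forall r r' z, 0 <= r <= 1 -> 0 <= r' <= 1 -> `|r - r'| < eta -> Z r z ->
  exists2 z', Z r' z' & normc (z - z') < e.

(* A jump below [delta / 2] already forces [f] to follow the nearest point of [Z], so this
   invariant survives gluing and yields continuity at the end. *)
Let partial_lift eta z1 c f := [/\ f 1 = z1,
  forall r, c <= r <= 1 -> Z r (f r) &
  forall r r', c <= r <= 1 -> c <= r' <= 1 -> `|r - r'| < eta ->
    normc (f r - f r') < delta / 2].

(** On the new piece, [g r] is any point of [Z r] within [delta / 4] of [f c]; no continuity of the
    choice is needed. *)
Let partial_lift_extend eta z1 c c' f :
  (forall r r' z, 0 <= r <= 1 -> 0 <= r' <= 1 -> `|r - r'| < eta -> Z r z ->
    exists2 z', Z r' z' & normc (z - z') < delta / 4) ->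
  0 <= c' -> c' <= c -> c <= 1 -> c - c' < eta ->
  partial_lift eta z1 c f -> exists f', partial_lift eta z1 c' f'.
Proof.
have d0 := delta_gt0; move=> near c'0 c'c c1 cc' [f1 fZ fclose].
have fcZ : Z c (f c) by apply: fZ; rewrite lexx c1.
have /choice[g gP] : forall r, exists z, c' <= r < c ->
    Z r z /\ normc (f c - z) < delta / 4.
  move=> r; have [rc|nrc] := boolP (c' <= r < c); last by exists 0.
  have [|||z' Zz' cz'] := near c r _ _ _ _ fcZ; last by exists z'.
  - by apply/andP; split; lra.
  - by case/andP: rc => *; apply/andP; split; lra.
  - by case/andP: rc => *; rewrite ger0_norm; lra.
(* The invariant puts [f r] within [delta / 2] of [f c], and some point of [Z r] lies within
   [delta / 4] of [f c]; by separation the two coincide. *)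
have close r : c <= r <= 1 -> r - c < eta -> normc (f c - f r) < delta / 4.
  move=> /andP[cr r1] rc.
  have [|||z' Zz' cz'] := near c r _ _ _ _ fcZ.
  - by apply/andP; split; lra.
  - by apply/andP; split; lra.
  - by rewrite ler0_norm; lra.
  have : normc (f c - f r) < delta / 2.
    apply: fclose; rewrite ?lexx ?cr //.
    by rewrite ler0_norm; lra.
  have := normc_triangle (f r) (f c) z'; rewrite (normc_distC (f r) (f c)) => tri lt.
  suff -> : f r = z' by [].
  by apply: (@Z_sep r) => //; [apply/andP; split; lra|apply: fZ; rewrite cr|lra].
exists (fun r => if c <= r then f r else g r); split.
- by rewrite c1.
- move=> r /andP[c'r r1]; case: (leP c r) => [cr|rc]; first by apply: fZ; rewrite cr.
  by apply: (gP r _).1; rewrite c'r.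
- move=> r r' /andP[c'r r1] /andP[c'r' r'1] rr'.
  (* Unless both points lie in [c, 1], both values are within [delta / 4] of [f c]. *)
  case: (leP c r) => [cr|rc]; case: (leP c r') => [cr'|r'c].
  + by apply: fclose => //; rewrite ?cr ?cr'.
  + have /gP[_ g'] : c' <= r' < c by rewrite c'r'.
    have := @close r; rewrite cr r1 => /(_ isT).
    move: rr'; rewrite ltr_norml => /andP[_ rr'].
    have := normc_triangle (f r) (f c) (g r'); rewrite (normc_distC (f r) (f c)).
    by move=> tri h; have /h ? : r - c < eta; lra.
  + have /gP[_ g'] : c' <= r < c by rewrite c'r.
    have := @close r'; rewrite cr' r'1 => /(_ isT).
    move: rr'; rewrite ltr_norml => /andP[rr' _].
    have := normc_triangle (g r) (f c) (f r'); rewrite (normc_distC (g r) (f c)).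
    by move=> tri h; have /h ? : r' - c < eta; lra.
  + have /gP[_ g1] : c' <= r < c by rewrite c'r.
    have /gP[_ g2] : c' <= r' < c by rewrite c'r'.
    have := normc_triangle (g r) (f c) (g r'); rewrite (normc_distC (g r) (f c)); lra.
Qed.

Lemma exists_lift z1 : Z 1 z1 -> exists f : R -> R[i]^o,
  [/\ f 1 = z1, forall r, 0 <= r <= 1 -> Z r (f r) &
      {within `[0, 1], continuous f}].
Proof.
have d0 := delta_gt0; move=> Z1; have d4 : 0 < delta / 4 by lra.
have [eta eta0 near] := Z_near d4.
(* Induction on the number of steps of length [eta / 2], going down from 1 and cut off at 0;
   [2 / eta] steps suffice. *)
have lift m : exists f, partial_lift eta z1 (Num.max 0 (1 - m%:R * (eta / 2))) f.
  elim: m => [|m [f fP]].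
    exists (cst z1); rewrite mul0r subr0.
    have -> : Num.max 0 1 = 1 :> R by apply/max_idPr.
    split=> [//|r|r r' _ _ _ /=]; first by rewrite -eq_le => /eqP <-.
    by rewrite subrr normc0; lra.
  apply: (partial_lift_extend near _ _ _ _ fP).
  - by rewrite le_max lexx.
  - rewrite ge_max !le_max lexx /= -(natr1 m); apply/orP; right; nra.
  - rewrite ge_max ler01 gerBl mulr_ge0 // ltW //; lra.
  - rewrite -(natr1 m) mulrDl mul1r; move: (m%:R * (eta / 2)) => q.
    case: (leP 0 (1 - q)) => ?; case: (leP 0 (1 - (q + eta / 2))) => ?; lra.
have [f [f1 fZ fclose]] := lift (Num.bound (2 / eta)).
have c0 : Num.max 0 (1 - (Num.bound (2 / eta))%:R * (eta / 2)) = 0.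
  apply/max_idPl; rewrite subr_le0.
  have /ltW : 2 / eta < (Num.bound (2 / eta))%:R by apply: archi_boundP; apply: divr_ge0; lra.
  by rewrite ler_pdivrMr //; lra.
rewrite c0 in fZ fclose; exists f; split=> //.
apply/subspace_continuousP => r /=; rewrite in_itv /= => r01.
move=> U /nbhs_normcP[e e0 eU].
(* The nearby point of [Z s] is within [delta / 4] of [f r], while [f s] is within [delta / 2] of
   it, so that point is [f s]. *)
have em : 0 < Num.min e (delta / 4) by rewrite lt_min e0.
have [eta' eta'0 near'] := Z_near em.
have ee : 0 < Num.min eta eta' by rewrite lt_min eta0.
apply/nbhs_ballP; exists (Num.min eta eta') => //= s.
rewrite /ball /= lt_min => /andP[s1 s2]; rewrite in_itv /= => s01.
apply: eU; rewrite normc_distC.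
have [z' Zz'] := near' r s _ r01 s01 s2 (fZ _ r01).
rewrite lt_min => /andP[ze zd].
suff fs : f s = z' by move: ze; rewrite -fs.
apply: (@Z_sep s) => //; first exact: fZ.
have := fclose r s r01 s01 s1.
have := normc_triangle (f s) (f r) z'; rewrite (normc_distC (f s) (f r)); lra.
Qed.

(** The distance between the two lifts is continuous and is either 0 or at least [delta]; it cannot
    take the intermediate value [delta / 2]. *)
Lemma lift_unique (f g : R -> R[i]^o) :
  {within `[0, 1], continuous f} -> {within `[0, 1], continuous g} ->
  (forall r, 0 <= r <= 1 -> Z r (f r)) -> (forall r, 0 <= r <= 1 -> Z r (g r)) ->
  forall r s, 0 <= r <= 1 -> 0 <= s <= 1 -> f r = g r -> f s = g s.
Proof.
have d0 := delta_gt0; move=> cf cg fZ gZ r s r01 s01 fgr.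
have ch : {within `[0, 1], continuous (fun x => normc (f x - g x))}.
  by apply: within_continuous_normc_sub.
apply: contrapT => fgs.
have hs : delta <= normc (f s - g s).
  rewrite leNgt; apply/negP => lt; apply: fgs.
  by apply: (@Z_sep s) => //; [exact: fZ|exact: gZ].
have hr : normc (f r - g r) = 0 by rewrite fgr subrr normc0.
have [c c01 hc] : exists2 c, 0 <= c <= 1 & normc (f c - g c) = delta / 2.
  have sub x y : 0 <= x <= 1 -> 0 <= y <= 1 ->
      {within `[x, y], continuous (fun x => normc (f x - g x))}.
    move=> /andP[x0 x1] /andP[y0 y1]; apply: continuous_subspaceW ch => t /=.
    by rewrite !in_itv /= => /andP[? ?]; apply/andP; split; lra.
  have mid : Num.min (normc (f r - g r)) (normc (f s - g s)) <= delta / 2 <=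
      Num.max (normc (f r - g r)) (normc (f s - g s)).
    by rewrite hr ge_min le_max; apply/andP; split; apply/orP; [left|right]; lra.
  have [rs|/ltW sr] := leP r s.
    have [c] := IVT rs (sub _ _ r01 s01) mid; rewrite in_itv /= => ? ?.
    by exists c => //; apply/andP; split; lra.
  rewrite minC maxC in mid.
  have [c] := IVT sr (sub _ _ s01 r01) mid; rewrite in_itv /= => ? ?.
  by exists c => //; apply/andP; split; lra.
have fgc : f c = g c.
  by apply: (@Z_sep c) => //; [exact: fZ|exact: gZ|lra].
by move: hc; rewrite fgc subrr normc0; lra.
Qed.

End Lifting.

(** * Fibres over a regular ray *)

Lemma seq_pos_lower_bound (R : realFieldType) (T : eqType) (s : seq T) (f : T -> R) :
  (forall x, x \in s -> 0 < f x) ->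
  exists2 rho, 0 < rho & forall x, x \in s -> rho <= f x.
Proof.
elim: s => [|x s IH] f0; first by exists 1.
have [|rho rho0 rhof] := IH; first by move=> y ys; rewrite f0 // in_cons ys orbT.
exists (Num.min (f x) rho); first by rewrite lt_min rho0 f0 ?mem_head.
move=> y; rewrite in_cons ge_min => /predU1P[->|/rhof ->]; rewrite ?lexx //.
by rewrite orbT.
Qed.

Lemma seq_separation (R : realType) (s : seq R[i]) :
  exists2 rho, 0 < rho &
    forall x y, x \in s -> y \in s -> normc (x - y) < rho -> x = y.
Proof.
have [p|rho rho0 rhoP] := @seq_pos_lower_bound R _
    [seq p <- [seq (x, y) | x <- s, y <- s] | p.1 != p.2]
    (fun p => normc (p.1 - p.2)).
  rewrite mem_filter => /andP[p12 _].
  by rewrite lt_neqAle normc_ge0 andbT eq_sym normc_eq0 subr_eq0.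
exists rho => // x y xs ys lt; apply/eqP/negPn/negP => xy.
have /rhoP/= : (x, y) \in [seq p <- [seq (x, y) | x <- s, y <- s] | p.1 != p.2].
  by rewrite mem_filter xy; apply/allpairsP; exists (x, y).
by rewrite leNgt lt.
Qed.

Section RayFibers.
Variables (R : realType) (n : nat) (a : 'I_n -> R[i]) (eps : R[i]).
Hypothesis n_gt0 : (0 < n)%N.
Hypothesis a_lt1 : forall k, normc (a k) < 1.
Hypothesis eps1 : normc eps = 1.
Implicit Types (w z u : R[i]) (r : R).

(** No root is a pole: the roots lie in the closed disk, where D has no zero. *)
Lemma blaschke_fiber w z : normc w <= 1 ->
  root (fiber_poly a eps w) z <-> blaschke_dom a z /\ blaschke a eps z = w.
Proof.
move=> w1; split=> [h|[/blaschke_domE d0 <-]].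
  have dz := closed_disk_dom a_lt1 (fiber_in_disk n_gt0 a_lt1 eps1 w1 h).
  split=> //; move: h; rewrite root_fiber_poly blaschkeE => /eqP ->.
  by rewrite mulfK //; apply/blaschke_domE.
by rewrite root_fiber_poly blaschkeE divfK.
Qed.

Lemma blaschke_near e : 0 < e -> exists2 eta, 0 < eta &
  forall w z, normc w <= 1 -> normc z <= 1 ->
    normc (blaschke a eps z - w) < eta ->
  exists2 z', root (fiber_poly a eps w) z' & normc (z - z') < e.
Proof.
move=> e0; have gap := lead_gap_gt0 n_gt0 a_lt1.
have c0 : 0 < 2 ^+ n / lead_gap a by rewrite divr_gt0 // exprn_gt0.
(* This [eta] makes the bound of [blaschke_fiber_dist] equal to [e ^+ n]. *)
exists (e ^+ n / (2 ^+ n / lead_gap a)); first by rewrite divr_gt0 // exprn_gt0.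
move=> w z w1 z1; rewrite ltr_pdivlMr // mulrC => lt.
have [z' rz' le] := blaschke_fiber_dist n_gt0 a_lt1 eps1 w1 z1.
exists z' => //; move: (le_lt_trans le lt).
by rewrite ltr_pXn2r // nnegrE ?normc_ge0 // ltW.
Qed.

Variable u : R[i].
Hypothesis u1 : normc u = 1.
Hypothesis ray_regular : forall r z, 0 <= r <= 1 ->
  root (fiber_poly a eps (r%:C * u)) z -> (bwronskian a eps).[z] != 0.

Definition ray_fiber r : set R[i] := [set z | root (fiber_poly a eps (r%:C * u)) z].

Lemma normc_ray r : 0 <= r -> normc (r%:C * u) = r.
Proof. by move=> r0; rewrite normcM u1 mulr1 normc_real ger0_norm. Qed.

Lemma normc_ray_le1 r : 0 <= r <= 1 -> normc (r%:C * u) <= 1.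
Proof. by move=> /andP[r0 r1]; rewrite normc_ray. Qed.

Lemma ray_fiber_near e : 0 < e -> exists2 eta, 0 < eta &
  forall r r' z, 0 <= r <= 1 -> 0 <= r' <= 1 -> `|r - r'| < eta ->
    ray_fiber r z -> exists2 z', ray_fiber r' z' & normc (z - z') < e.
Proof.
move=> e0; have [eta eta0 near] := blaschke_near e0.
exists eta => // r r' z r01 r'01 rr' rz.
have [|||z'] := near (r'%:C * u) z; last by exists z'.
- exact: normc_ray_le1.
- exact: (fiber_in_disk n_gt0 a_lt1 eps1 (normc_ray_le1 r01) rz).
- have [_ ->] := (blaschke_fiber z (normc_ray_le1 r01)).1 rz.
  by rewrite -mulrBl -rmorphB normcM u1 mulr1 normc_real.
Qed.

Lemma ray_fiber_seq r : 0 <= r <= 1 -> exists rs : seq R[i],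
  [/\ size rs = n, uniq rs & forall z, (z \in rs) = (z \in ray_fiber r)].
Proof.
move=> r01.
have [|rs [sz un mem]] := fiber_simple_roots n_gt0 a_lt1 eps1 (normc_ray_le1 r01).
  by move=> z; exact: (ray_regular r01).
by exists rs; split => // z; rewrite mem; apply/idP/idP; rewrite inE.
Qed.

(** Near [r0] each root over [r0] has a root over [r] close to it. These are distinct and n in
    number, so they form the whole fibre and inherit a separation; compactness of [0, 1] makes it
    uniform. *)
Lemma ray_fiber_sep : exists2 delta, 0 < delta & forall r x y, 0 <= r <= 1 ->
  ray_fiber r x -> ray_fiber r y -> normc (x - y) < delta -> x = y.
Proof.
pose P (d : R) r := forall x y, ray_fiber r x -> ray_fiber r y ->
  normc (x - y) < d -> x = y.
have /near_covering_withinP cover : near_covering `[(0 : R), 1]%classic.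
  exact/compact_near_coveringP/segment_compact.
have : \forall d \near (0 : R)^'+, `[(0 : R), 1]%classic `<=` P d.
  apply: cover => r0 /=; rewrite in_itv /= => r001.
  have [rs0 [sz0 un0 mem0]] := ray_fiber_seq r001.
  have [rho rho0 sep0] := seq_separation rs0.
  have [eta eta0 near] := ray_fiber_near (divr_gt0 rho0 (ltr0n R 4)).
  (* Roots move by less than [rho / 4], so two roots over [r] closer than [rho / 2] come from roots
     over [r0] closer than [rho]. *)
  exists ([set r | `|r0 - r| < eta], [set d | d < rho / 2]).
    split => /=; first by apply/nbhs_ballP; exists eta.
    by apply: nbhs_right_lt; rewrite divr_gt0.
  move=> [r d] /= [rr0 dlt]; rewrite in_itv /= => r01.
  have [rs [sz un mem]] := ray_fiber_seq r01.
  have /choice[g gP] : forall x, exists y, x \in rs0 ->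
      y \in rs /\ normc (x - y) < rho / 4.
    move=> x; have [xrs0|] := boolP (x \in rs0); last by exists 0.
    have [|y yr xy] := near r0 r x r001 r01 rr0; last first.
      by exists y => _; rewrite mem inE.
    by move: xrs0; rewrite mem0 inE.
  have gmem : {subset map g rs0 <= rs}.
    by move=> y /mapP[x xrs0 ->]; apply: (gP x xrs0).1.
  have guniq : uniq (map g rs0).
    rewrite map_inj_in_uniq // => x x' xs x's gg; apply: sep0 => //.
    have [_ h] := gP x xs; have [_ h'] := gP x' x's.
    have := normc_triangle x (g x) x'.
    rewrite {2}gg (normc_distC (g x') x'); lra.
  have szle : (size rs <= size (map g rs0))%N by rewrite size_map sz sz0.
  have [_ geq] := uniq_min_size guniq gmem szle.
  move=> y y' yr y'r lt.
  have /mapP[x xs yx] : y \in map g rs0 by rewrite geq mem inE.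
  have /mapP[x' x's yx'] : y' \in map g rs0 by rewrite geq mem inE.
  suff xx' : x = x' by rewrite yx yx' xx'.
  apply: sep0 => //.
  have [_ h] := gP x xs; have [_ h'] := gP x' x's.
  have := normc_triangle x (g x) x'.
  have := normc_triangle (g x) (g x') x'.
  rewrite (normc_distC (g x') x'); rewrite yx yx' in lt; lra.
move=> sep; near (0 : R)^'+ => d; exists d => // r x y r01.
by apply: (near sep d) => //=; rewrite in_itv.
Unshelve. all: by end_near. Qed.

End RayFibers.

(** * Polar coordinates in the complex plane *)

Section PolarForm.
Variable R : realType.
Implicit Types (t r : R) (w : R[i]).

(** The hypotheses give cos(x - y) = 1, hence sin((x - y) / 2) = 0, and the half difference lies
    strictly between -pi and pi. *)
Lemma cis_inj x y : `|x - y| < 2 * pi -> cis x = cis y :> R[i] -> x = y.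
Proof.
rewrite ltr_norml => /andP[xy1 xy2] [cxy sxy].
have c1 : cos (x - y) = 1 by rewrite cosB cxy sxy -!expr2 cos2Dsin2.
have s0 : sin ((x - y) / 2) = 0.
  have := cos_mulr2n ((x - y) / 2).
  have -> : (x - y) / 2 *+ 2 = x - y by rewrite -mulr_natr divfK.
  rewrite c1 => h.
  have := cos2Dsin2 ((x - y) / 2) => h2.
  apply/eqP; rewrite -sqrf_eq0; apply/eqP; lra.
have := pi_gt0 R => pi0.
apply/eqP; rewrite eq_le !leNgt; apply/andP; split; apply/negP => lt.
- have := @sin_gt0_pi R ((x - y) / 2); rewrite s0 ltxx => h.
  suff // : false by []; apply: h; apply/andP; split; lra.
- have := @sin_gt0_pi R ((y - x) / 2); rewrite -opprB mulNr sinN s0 oppr0 ltxx => h.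
  suff // : false by []; apply: h; apply/andP; split; lra.
Qed.

Lemma cis_surj w : normc w = 1 -> exists2 t, param_interval t & w = cis t.
Proof.
case: w => x y /(congr1 (fun z => z ^+ 2)).
rewrite normc_sqr /= expr1n => xy1.
have x11 : -1 <= x <= 1.
  have := sqr_ge0 y => ?; apply/andP; split; nra.
have sx : sin (acos x) = `|y|.
  by rewrite sin_acos // -xy1 addrAC subrr add0r sqrtr_sqr.
have cx : cos (acos x) = x by rewrite acosK // in_itv.
have := pi_gt0 R; have := acos_ge0 x11; have := acos_lepi x11 => a1 a2 pi0.
(* The case [y = 0] goes with [- acos x], so that -1 gets the parameter -pi, which the half-open
   interval contains. *)
have [y0|y0] := ltP 0 y; [exists (acos x)|exists (- acos x)].
- rewrite /param_interval /= in_itv /=; apply/andP; split; first lra.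
  rewrite lt_neqAle a1 andbT; apply/eqP => api.
  by move: sx; rewrite api sinpi gtr0_norm // => y00; rewrite -y00 ltxx in y0.
- by rewrite /cis cx sx gtr0_norm.
- rewrite /param_interval /= in_itv /=; apply/andP; split; lra.
- by rewrite /cis cosN sinN cx sx ler0_norm // opprK.
Qed.

Lemma polar_inj r r' t t' : 0 < r -> 0 < r' ->
  param_interval t -> param_interval t' ->
  r%:C * cis t = r'%:C * cis t' -> r = r' /\ t = t'.
Proof.
move=> r0 r'0; rewrite /param_interval /= !in_itv /= => /andP[t1 t2] /andP[t'1 t'2] e.
have rr : r = r'.
  move/(congr1 (@normc R)): e.
  by rewrite !normcM !normc_cis !normc_real !mulr1 !gtr0_norm.
split=> //; apply: cis_inj; first by rewrite ltr_norml; apply/andP; split; lra.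
move: e; rewrite -rr; apply: mulfI.
by rewrite -normc_eq0 normc_real normr_eq0 gt_eqF.
Qed.

Lemma cis_continuous t e : 0 < e -> exists2 d, 0 < d &
  forall s, `|t - s| < d -> normc (cis t - cis s) < e.
Proof.
move=> e0; have e2 : 0 < e / 2 by lra.
have /cvgrPdist_lt/(_ _ e2)/nbhs_ballP[d1 /= d10 cosP] := @continuous_cos R t.
have /cvgrPdist_lt/(_ _ e2)/nbhs_ballP[d2 /= d20 sinP] := @continuous_sin R t.
exists (Num.min d1 d2); first by rewrite lt_min d10.
move=> s; rewrite lt_min => /andP[/cosP cs /sinP ss].
have sq (x : R) : `|x| < e / 2 -> x ^+ 2 < (e / 2) ^+ 2.
  by move=> xe; rewrite -real_normK ?num_real // ltr_pXn2r ?nnegrE // ltW.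
rewrite -[ltRHS]gtr0_norm // -sqrtr_sqr ltr_sqrt ?exprn_gt0 //.
have := sq _ cs; have := sq _ ss; nra.
Qed.

Lemma cis_addn t k : cis (t + 2 * k%:R * pi) = cis t.
Proof.
have -> : t + 2 * k%:R * pi = t + (pi *+ 2) *+ k.
  by rewrite -mulr_natr -[pi *+ 2]mulr_natr; congr (_ + _); ring.
by rewrite /cis (periodicn (@cosD2pi R)) (periodicn (@sinD2pi R)).
Qed.

End PolarForm.

(** * The boundary argument and its inverse branches *)

Section BoundaryArgument.
Variables (R : realType) (n : nat) (a : 'I_n -> R[i]) (eps : R[i]) (beta : R -> R).
Hypothesis n_gt0 : (0 < n)%N.
Hypothesis betaP : blaschke_argument a eps beta.

(** Shifting by enough periods in both directions brackets [y]; the intermediate value theorem does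
    the rest. *)
Lemma beta_surj y : exists x, beta x = y.
Proof.
have [_ per cont _] := betaP.
have up m : beta (m%:R * (2 * pi)) = beta 0 + m%:R * (2 * pi).
  elim: m => [|m IH]; first by rewrite !mul0r addr0.
  by rewrite -natr1 mulrDl mul1r per IH addrA.
have down m : beta (- (m%:R * (2 * pi))) = beta 0 - m%:R * (2 * pi).
  elim: m => [|m IH]; first by rewrite !mul0r oppr0 addr0.
  have := per (- (m.+1%:R * (2 * pi))).
  rewrite -(natr1 m) mulrDl mul1r opprD addrNK IH; lra.
have pi0 := pi_gt0 R; have p0 : 0 < 2 * pi :> R by rewrite mulr_gt0.
pose m := Num.bound (`|y - beta 0| / (2 * pi)).
have mb : `|y - beta 0| < m%:R * (2 * pi).
  by rewrite -ltr_pdivrMr //; apply: archi_boundP; rewrite divr_ge0 // ltW.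
have m0 : 0 <= m%:R * (2 * pi) :> R by rewrite mulr_ge0 // ltW.
move: mb; rewrite ltr_norml => /andP[mb1 mb2].
have [|||c _ cy] := @IVT R beta (- (m%:R * (2 * pi))) (m%:R * (2 * pi)) y.
- lra.
- exact: continuous_subspaceT.
- rewrite up down ge_min le_max; apply/andP.
  by split; apply/orP; [left|right]; lra.
by exists c.
Qed.

Lemma beta_tau (k : 'I_n) t : beta (tau beta k t) = t / n%:R + 2 * k%:R * pi / n%:R :> R.
Proof.
rewrite /tau pinvK // inE.
by have [x xy] := beta_surj (t / n%:R + 2 * k%:R * pi / n%:R); exists x.
Qed.

Lemma blaschke_cis_tau (k : 'I_n) t : blaschke a eps (cis (tau beta k t)) = cis t.
Proof.
have [_ _ _ ->] := betaP; rewrite beta_tau -mulrDl mulrC divfK ?cis_addn //.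
by rewrite pnatr_eq0 -lt0n.
Qed.

Lemma cis_tau_inj t : injective (fun k : 'I_n => cis (tau beta k t)).
Proof.
have [incr per _ _] := betaP; have pi0 := pi_gt0 R.
have nR : 0 < n%:R :> R by rewrite ltr0n.
(* After applying [beta] this reads 2 j pi / n < 2 k pi / n + 2 pi, true since j < n. So two of
   these parameters differ by less than a period of [cis]. *)
have lt2pi (j k : 'I_n) : tau beta j t < tau beta k t + 2 * pi.
  rewrite -(leW_mono (le_mono incr)) per !beta_tau.
  rewrite -addrA ltrD2l -[2 * pi in ltRHS](mulfK (lt0r_neq0 nR)) -mulrDl.
  rewrite ltr_pM2r ?invr_gt0 //.
  have : j%:R < n%:R :> R by rewrite ltr_nat.
  have : 0 <= k%:R :> R by [].
  move: (j%:R) (k%:R) (n%:R) => x y z y0 xz; nra.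
move=> j k /cis_inj h; have {h}/(congr1 beta) : tau beta j t = tau beta k t.
  by apply: h; rewrite ltr_norml; apply/andP; have := lt2pi j k;
    have := lt2pi k j; split; lra.
rewrite !beta_tau => /addrI /(mulIf (invr_neq0 (lt0r_neq0 nR))).
move=> /(mulIf (lt0r_neq0 pi0)) /(mulfI _) h; apply/val_inj/eqP.
by rewrite -(eqr_nat R) h // pnatr_eq0.
Qed.

End BoundaryArgument.

(** * Abundance of regular parameters *)

Section RegularParameters.
Variables (R : realType) (n : nat) (a : 'I_n -> R[i]) (eps : R[i]).
Hypothesis n_gt0 : (0 < n)%N.
Hypothesis a_lt1 : forall k, normc (a k) < 1.
Hypothesis eps1 : normc eps = 1.

Lemma regular_fiber t r z : regular_params a eps t -> 0 <= r <= 1 ->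
  root (fiber_poly a eps (r%:C * cis t)) z -> (bwronskian a eps).[z] != 0.
Proof.
move=> [pt reg] r01 rz; apply/negP => /eqP W0; apply: reg; split => //.
have [d0 bz] := (blaschke_fiber n_gt0 a_lt1 eps1 z
  (normc_ray_le1 (normc_cis t) r01)).1 rz.
exists (r%:C * cis t); first by exists r => //=; rewrite in_itv.
exists z => //; split => //.
by rewrite derive1_blaschke // W0 mul0r.
Qed.

(* [r > 0] because 0 lies on the regular segment of [t0]. *)
Lemma critical_value_of_param t0 t :
  regular_params a eps t0 -> critical_params a eps t ->
  exists b, root (bwronskian a eps) b /\
    exists2 r, 0 < r & blaschke a eps b = r%:C * cis t.
Proof.
move=> [pt0 reg0] [pt [w [r /=]]]; rewrite in_itv /= => /andP[r0 r1] <-.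
move=> [b cb wb]; have [domb db] := cb; exists b; split.
  move: db; rewrite derive1_blaschke // => /eqP.
  rewrite mulf_eq0 invr_eq0 expf_eq0 /= => /orP[//|].
  by move/blaschke_domE/negPf: domb => ->.
exists r => //; rewrite lt_neqAle r0 andbT eq_sym; apply/eqP => r00.
apply: reg0; split => //; exists 0.
  by exists 0; rewrite /= ?in_itv /= ?lexx ?ler01 // mul0r.
by exists b => //; rewrite -wb r00 mul0r.
Qed.

Lemma bwronskian_neq0 t : regular_params a eps t -> bwronskian a eps != 0.
Proof.
move=> reg; apply/eqP => W0.
have n0 : normc (0%:C * cis t) <= 1 :> R by rewrite mul0r normc0.
(* The estimate serves only to produce a root in the fibre over 0. *)
have [|z rz _] := blaschke_fiber_dist n_gt0 a_lt1 eps1 n0 (z := 0).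
  by rewrite normc0.
by have := regular_fiber reg _ rz; rewrite lexx ler01 W0 horner0 eqxx => /(_ isT).
Qed.

(** Otherwise every parameter just above [t] is critical, and distinct parameters yield distinct
    zeros of the nonzero polynomial [bwronskian]: more than its degree allows. *)
Lemma regular_params_dense t0 t d : regular_params a eps t0 ->
  param_interval t -> 0 < d ->
  exists2 s, regular_params a eps s & t <= s < t + d.
Proof.
move=> reg0; rewrite /param_interval /= in_itv /= => /andP[t1 t2] d0.
apply: contrapT => noreg.
(* The cut at pi keeps the window inside [param_interval]. *)
pose e := Num.min d (pi - t); have e0 : 0 < e by rewrite lt_min d0 subr_gt0.
have [ed ep] : e <= d /\ e <= pi - t by rewrite !ge_min !lexx orbT.
have /choice[b bP] : forall s, exists b, t <= s < t + e ->
    root (bwronskian a eps) b /\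
    exists2 r, 0 < r & blaschke a eps b = r%:C * cis s.
  move=> s; have [/andP[s1 s2]|] := boolP (t <= s < t + e); last by exists 0.
  have ps : param_interval s by rewrite /param_interval /= in_itv /=; apply/andP; split; lra.
  have [cs|ncs] := pselect (critical_params a eps s).
    by have [z zP] := critical_value_of_param reg0 cs; exists z.
  by exfalso; apply: noreg; exists s => //; apply/andP; split; lra.
pose N := size (bwronskian a eps).
pose p (j : nat) := t + e * (j%:R / N%:R).
have pP j : (j < N)%N -> t <= p j < t + e.
  move=> jN; have N0 : (0 < N)%N by exact: leq_trans jN.
  rewrite lerDl mulr_ge0 ?divr_ge0 // ?(ltW e0) //= ltrD2l gtr_pMr //.
  by rewrite ltr_pdivrMr ?ltr0n // mul1r ltr_nat.
have := @max_poly_roots _ (bwronskian a eps) [seq b (p j) | j <- iota 0 N]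
  (bwronskian_neq0 reg0).
rewrite size_map size_iota ltnn => /(_ _ _)/implyP.
suff -> : all (root (bwronskian a eps)) [seq b (p j) | j <- iota 0 N].
  suff -> : uniq [seq b (p j) | j <- iota 0 N] by move=> /(_ isT isT).
  rewrite map_inj_in_uniq ?iota_uniq // => j k.
  rewrite !mem_iota /= add0n => jN kN.
  have := pP j jN; have := pP k kN.
  move=> /[dup] pk /bP[_ [r r0 rE]] /[dup] pj /bP[_ [r' r'0 r'E]] bb.
  move: r'E; rewrite bb rE => /polar_inj h.
  have pr x : t <= x < t + e -> param_interval x.
    by move=> /andP[? ?]; rewrite /param_interval /= in_itv /=; apply/andP; split; lra.
  (* Equal zeros have equal, nonzero critical values, whose polar form determines the parameter. *)
  have [_ /addrI /(mulfI (lt0r_neq0 e0))] := h r0 r'0 (pr _ pk) (pr _ pj).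
  have N0 : (0 < N)%N by exact: leq_trans jN.
  have NR : N%:R != 0 :> R by rewrite pnatr_eq0 -lt0n.
  by move=> /(mulIf (invr_neq0 NR))/eqP; rewrite eqr_nat => /eqP.
apply/allP => z /mapP[j]; rewrite mem_iota /= add0n => jN ->.
by have [] := bP _ (pP j jN).
Qed.

End RegularParameters.

(** * Solution curves over regular parameters *)

Lemma closed_diskE (R : realType) (z : R[i]) : closed_disk z <-> normc z <= 1.
Proof.
rewrite /closed_disk /=; split; last by move=> ?; rewrite normCE lecR.
by rewrite normCE lecR.
Qed.

Section SolutionCurves.
Variables (R : realType) (n : nat) (a : 'I_n -> R[i]) (eps : R[i]) (beta : R -> R).
Hypothesis n_gt0 : (0 < n)%N.
Hypothesis a_lt1 : forall k, normc (a k) < 1.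
Hypothesis eps1 : normc eps = 1.
Hypothesis betaP : blaschke_argument a eps beta.
Variable t : R.
Hypothesis t_regular : regular_params a eps t.

Let Z := ray_fiber a eps (cis t).

Let ZP r z : 0 <= r <= 1 ->
  Z r z <-> blaschke_dom a z /\ blaschke a eps z = r%:C * cis t.
Proof.
move=> r01; apply: blaschke_fiber => //; exact: (normc_ray_le1 (normc_cis t)).
Qed.

Let ray_regular r z : 0 <= r <= 1 ->
  root (fiber_poly a eps (r%:C * cis t)) z -> (bwronskian a eps).[z] != 0.
Proof. exact: (regular_fiber n_gt0 a_lt1 eps1 t_regular). Qed.

Lemma exists_solution_curve (k : 'I_n) : exists f, solution_curve a eps beta k t f.
Proof.
have [d d0 sep] := ray_fiber_sep n_gt0 a_lt1 eps1 (normc_cis t) ray_regular.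
have near := ray_fiber_near n_gt0 a_lt1 eps1 (normc_cis t).
have Z1 : Z 1 (cis (tau beta k t)).
  apply/ZP; first by rewrite ler01 lexx.
  split; first by apply: closed_disk_dom => //; rewrite normc_cis.
  by rewrite (blaschke_cis_tau n_gt0 betaP) mul1r.
have [f [f1 fZ cf]] := exists_lift d0 sep near Z1.
exists f; split => // r r01; apply/ZP => //; exact: fZ.
Qed.

(** The indices may differ: a common endpoint at 1 gives uniqueness, distinct endpoints give
    disjointness. *)
Lemma solution_curve_eq (j k : 'I_n) f g r s :
  solution_curve a eps beta j t f -> solution_curve a eps beta k t g ->
  0 <= r <= 1 -> 0 <= s <= 1 -> f r = g r -> f s = g s.
Proof.
have [d d0 sep] := ray_fiber_sep n_gt0 a_lt1 eps1 (normc_cis t) ray_regular.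
move=> [cf fP _] [cg gP _]; apply: (lift_unique d0 sep cf cg).
  by move=> x x01; apply/ZP => //; exact: fP.
by move=> x x01; apply/ZP => //; exact: gP.
Qed.

Lemma solution_curves_inj (f : 'I_n -> R -> R[i]^o) r :
  (forall k, solution_curve a eps beta k t (f k)) -> 0 <= r <= 1 ->
  injective (fun k => f k r).
Proof.
move=> fP r01 j k fr; apply: (cis_tau_inj n_gt0 betaP (t := t)) => /=.
have [_ _ <-] := fP j; have [_ _ <-] := fP k.
by apply: solution_curve_eq (fP j) (fP k) r01 _ fr; rewrite ler01 lexx.
Qed.

(** The n curves take distinct values in a fibre of n points, so they exhaust it. *)
Lemma solution_curves_cover (f : 'I_n -> R -> R[i]^o) r z :
  (forall k, solution_curve a eps beta k t (f k)) -> 0 <= r <= 1 ->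
  normc z <= 1 -> blaschke a eps z = r%:C * cis t -> exists k, f k r = z.
Proof.
move=> fP r01 z1 bz.
have [rs [sz un mem]] :=
  ray_fiber_seq n_gt0 a_lt1 eps1 (normc_cis t) ray_regular r01.
have funiq : uniq [seq (f k r : R[i]) | k <- enum 'I_n].
  by rewrite map_inj_uniq ?enum_uniq //; exact: solution_curves_inj.
have fsub : {subset [seq (f k r : R[i]) | k <- enum 'I_n] <= rs}.
  move=> y /mapP[k _ ->]; rewrite mem inE; apply/ZP => //.
  by have [_ fk _] := fP k; exact: fk.
have fsz : (size rs <= size [seq (f k r : R[i]) | k <- enum 'I_n])%N.
  by rewrite size_map size_enum_ord sz.
have [_ feq] := uniq_min_size funiq fsub fsz.
have : z \in [seq (f k r : R[i]) | k <- enum 'I_n].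
  rewrite feq mem inE; apply/ZP => //.
  by split => //; exact: closed_disk_dom.
by move=> /mapP[k _ ->]; exists k.
Qed.

End SolutionCurves.

Theorem theorem1 (R : realType) (n : nat) (a : 'I_n -> R[i]) (eps : R[i])
    (beta : R -> R) :
  (1 <= n)%N ->
  (forall k, `|a k| < 1) ->
  `|eps| = 1 ->
  blaschke_argument a eps beta ->
  exists phi : 'I_n -> R -> R -> R[i]^o,
    let curves : set R[i]^o :=
      \bigcup_(t in regular_params a eps) \bigcup_(k in [set: 'I_n])
        [set phi k r t | r in `[0, 1]] in
    [/\ forall t, regular_params a eps t -> forall k,
          solution_curve a eps beta k t (fun r => phi k r t) /\
          (forall psi, solution_curve a eps beta k t psi ->
             forall r, 0 <= r <= 1 -> psi r = phi k r t),
        forall t t' k k' r r',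
          regular_params a eps t -> regular_params a eps t' ->
          0 < r <= 1 -> 0 < r' <= 1 ->
          phi k r t = phi k' r' t' -> k = k' /\ t = t',
        curves = closed_disk `&`
          blaschke a eps @^-1` (\bigcup_(t in regular_params a eps) segment t) &
        regular_params a eps !=set0 -> closure curves = closed_disk].
Proof.
move=> n_gt0 a1 e1 betaP.
have a_lt1 k : normc (a k) < 1 by have := a1 k; rewrite normCE ltcR.
have eps1 : normc eps = 1 by move: e1; rewrite normCE => -[].
(* Curves are chosen for all pairs at once, with a constant default at parameters that are not
   regular. *)
have /choice[F FP] : forall kt : 'I_n * R, exists f, regular_params a eps kt.2 ->
    solution_curve a eps beta kt.1 kt.2 f.
  move=> [k t] /=; have [reg|] := pselect (regular_params a eps t); last first.
    by exists (cst 0).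
  have [f fP] := exists_solution_curve n_gt0 a_lt1 eps1 betaP reg k.
  by exists f.
exists (fun k r t => F (k, t) r) => curves.
have solP t (reg : regular_params a eps t) k :
    solution_curve a eps beta k t (F (k, t)) by exact: (FP (k, t)).
have curvesE : curves = closed_disk `&`
    blaschke a eps @^-1` (\bigcup_(t in regular_params a eps) segment t).
  apply/seteqP; split=> z.
    move=> [t reg [k _ [r /=]]]; rewrite in_itv /= => r01 <-.
    have [_ /(_ r r01)[dom bz] _] := solP t reg k; split.
      apply/closed_diskE; apply: (fiber_in_disk n_gt0 a_lt1 eps1
        (normc_ray_le1 (normc_cis t) r01)).
      by apply/blaschke_fiber => //; exact: (normc_ray_le1 (normc_cis t)).
    by exists t => //; exists r; rewrite /= ?in_itv.
  move=> [/closed_diskE z1 [t reg [r /=]]]; rewrite in_itv /= => r01 bz.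
  have [k kz] := solution_curves_cover n_gt0 a_lt1 eps1 betaP reg (solP t reg) r01 z1
    (esym bz).
  by exists t => //; exists k => //; exists r; rewrite /= ?in_itv.
split=> //.
- move=> t reg k; split=> [|psi psiP r r01]; first exact: solP.
  have [_ _ psi1] := psiP; have [_ _ F1] := solP t reg k.
  apply: (solution_curve_eq n_gt0 a_lt1 eps1 reg psiP (solP t reg k) (r := 1) _ r01).
    by rewrite ler01 lexx.
  by rewrite psi1 F1.
- move=> t t' k k' r r' reg reg' /andP[r0 r1] /andP[r'0 r'1] FF.
  have r01 : 0 <= r <= 1 by rewrite ltW.
  have r'01 : 0 <= r' <= 1 by rewrite ltW.
  have [_ /(_ r r01)[_ bz] _] := solP t reg k.
  have [_ /(_ r' r'01)[_ bz'] _] := solP t' reg' k'.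
  (* Applying B to the common point equates two polar forms, so the curves lie over the same ray and
     meet at the same [r]. *)
  rewrite FF bz' in bz.
  have [rr tt] := polar_inj r'0 r0 reg'.1 reg.1 bz.
  split=> //; apply: (solution_curves_inj n_gt0 a_lt1 eps1 betaP reg (solP t reg) r01).
  by rewrite FF tt rr.
- move=> [t0 reg0]; rewrite curvesE; apply/seteqP; split=> z.
    (* A point outside the disk has a ball of radius [normc z - 1] that misses it. *)
    move=> zcl; apply/closed_diskE; rewrite leNgt; apply/negP => z1.
    have /zcl[w [[/closed_diskE w1 _] /= wz]] :
        nbhs z [set w | normc (w - z) < normc z - 1].
      by apply/nbhs_normcP; exists (normc z - 1); rewrite ?subr_gt0.
    by have := le_normcD (z - w) w; rewrite subrK normc_distC; lra.
  move=> /closed_diskE z1 U /nbhs_normcP[e e0 eU].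
  (* A zero of B already lies on a curve, as 0 is on the segment of [t0]; other values have a polar
     form. *)
  have [bz0|bz0] := eqVneq (blaschke a eps z) 0.
    exists z; split; last by apply: eU; rewrite subrr normc0.
    split; first exact/closed_diskE.
    by exists t0 => //; exists 0; rewrite /= ?in_itv /= ?mul0r ?bz0 // lexx ler01.
  have [eta eta0 near] := blaschke_near n_gt0 a_lt1 eps1 e0.
  have b1 := blaschke_le1 a_lt1 eps1 z1.
  set rho := normc (blaschke a eps z) in b1.
  have rho0 : 0 < rho by rewrite lt_neqAle eq_sym normc_eq0 bz0 normc_ge0.
  have rhoN : rho%:C != 0 :> R[i].
    by rewrite -normc_eq0 normc_real normr_eq0 gt_eqF.
  have [|theta ptheta btheta] := @cis_surj R (blaschke a eps z / rho%:C).
    by rewrite normcM normcV normc_real gtr0_norm // divff // gt_eqF.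
  have bE : blaschke a eps z = rho%:C * cis theta.
    by rewrite -btheta mulrC divfK.
  have [d d0 dP] := cis_continuous theta eta0.
  (* The value B(z) is rotated to a nearby regular ray with its modulus [rho] kept; as [rho <= 1],
     it moves by less than [eta], and the new fibre has a root within [e] of [z]. *)
  have [s regs /andP[s1 s2]] :=
    regular_params_dense n_gt0 a_lt1 eps1 reg0 ptheta d0.
  have rho01 : 0 <= rho <= 1 by rewrite ltW.
  have w1 := normc_ray_le1 (normc_cis s) rho01.
  have [|z' rz' zz'] := near (rho%:C * cis s) z w1 z1.
    rewrite bE -mulrBr normcM normc_real gtr0_norm //.
    apply: le_lt_trans (dP s _); first by rewrite ler_piMl ?normc_ge0.
    by rewrite ltr_norml; apply/andP; split; lra.
  exists z'; split; last by apply: eU; rewrite normc_distC.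
  split.
    by apply/closed_diskE; apply: (fiber_in_disk n_gt0 a_lt1 eps1 w1 rz').
  have [_ bz'] := (blaschke_fiber n_gt0 a_lt1 eps1 z' w1).1 rz'.
  by exists s => //; exists rho; rewrite /= ?in_itv.
Qed.
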